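(* Let $p$ be a prime number, $\mathbb{Z}_p=\mathbb{Z}/p\mathbb{Z}$. 1. The following maps $S:\mathbb{Z}_p\times\mathbb{Z}_p\to\mathbb{Z}_p\times\mathbb{Z}_p$ define indecomposable nondegenerate affine solutions $(\mathbb{Z}_p,S)$ of order $p$: (i) $S(x,y)=(q_1^{-1}y+(1-q_2q_1^{-1})x+h,\ q_2x-q_1h)$, for each $q_1,q_2\in\mathbb{Z}_p^*$ with $q_1\neq q_2$ and each $h\in\mathbb{Z}_p$; (ii) $S(x,y)=(q_1^{-1}y+h,\ q_2x+(1-q_2q_1^{-1})y-q_2h)$, for each $q_1,q_2\in\mathbb{Z}_p^*$ with $q_1\neq q_2$ and each $h\in\mathbb{Z}_p$; (iii) $S(x,y)=(y+h_1,\ x+h_2)$, for each $(h_1,h_2)\in\mathbb{Z}_p^2$ with $(h_1,h_2)\neq(0,0)$. 2. Any indecomposable nondegenerate affine solution of prime order $p$ is isomorphic to one of the solutions listed in (i), (ii), (iii).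
   Context: A braided set is a pair $(X,S)$ with $X$ a nonempty set and $S:X\times X\to X\times X$ a bijection such that $S_1S_2S_1=S_2S_1S_2$ on $X\times X\times X$, where $S_1=S\times \mathrm{id}$ and $S_2=\mathrm{id}\times S$. Write $S(x,y)=(g_x(y),f_y(x))$. It is nondegenerate if for each fixed $x$ the map $y\mapsto g_x(y)$ is a bijection of $X$ and for each fixed $y$ the map $x\mapsto f_y(x)$ is a bijection of $X$. A ''solution'' means a nondegenerate braided set; its order is $|X|$. A solution $(X,S)$ is decomposable if there is a partition of $X$ into two disjoint nonempty subsets $X_1,X_2$ with $S(X_1\times X_1)\subset X_1\times X_1$ and $S(X_2\times X_2)\subset X_2\times X_2$; it is indecomposable if it is not decomposable. If $X$ is an abelian group, a solution $(X,S)$ is affine if $S(x,y)=(ax+by+h,\ cx+dy+t)$ for some $a,b,c,d\in\mathrm{End}(X)$ and $h,t\in X$. Solutions $(X,S)$ and $(X',S')$ are isomorphic if there is a bijection $\theta:X\to X'$ with $(\theta\times\theta)\circ S=S'\circ(\theta\times\theta)$. $\mathbb{Z}_p^*$ denotes the group of nonzero elements of $\mathbb{Z}_p$ under multiplication. *)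

(* Defs.v *)
From mathcomp Require Import all_boot all_algebra.

Set Implicit Arguments.
Unset Strict Implicit.
Unset Printing Implicit Defensive.

Import GRing.Theory.
Local Open Scope ring_scope.

Definition S1 (X : Type) (S : X * X -> X * X) (u : X * X * X) : X * X * X :=
  let: (x, y, z) := u in (S (x, y), z).

Definition S2 (X : Type) (S : X * X -> X * X) (u : X * X * X) : X * X * X :=
  let: (x, y, z) := u in let: (y', z') := S (y, z) in (x, y', z').

Definition braided_set (X : Type) (S : X * X -> X * X) : Prop :=
  [/\ inhabited X, bijective S &
      S1 S \o S2 S \o S1 S =1 S2 S \o S1 S \o S2 S].

(* [S (x, y) = (g_x y, f_y x)], i.e. [(S (x, y)).1] is [g_x y]. *)
Definition nondegenerate (X : Type) (S : X * X -> X * X) : Prop :=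
  (forall x : X, bijective (fun y : X => (S (x, y)).1)) /\
  (forall y : X, bijective (fun x : X => (S (x, y)).2)).

Definition solution (X : Type) (S : X * X -> X * X) : Prop :=
  braided_set S /\ nondegenerate S.

Definition square_stable (X : Type) (S : X * X -> X * X) (A : X -> Prop) :
    Prop :=
  forall x y : X, A x -> A y -> A (S (x, y)).1 /\ A (S (x, y)).2.

Definition decomposable (X : Type) (S : X * X -> X * X) : Prop :=
  exists X1 X2 : X -> Prop,
    [/\ (exists x : X, X1 x) /\ (exists x : X, X2 x),
        forall x : X, X1 x \/ X2 x,
        forall x : X, ~ (X1 x /\ X2 x),
        square_stable S X1 & square_stable S X2].

Definition indecomposable (X : Type) (S : X * X -> X * X) : Prop :=
  ~ decomposable S.

Definition affine (X : zmodType) (S : X * X -> X * X) : Prop :=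
  exists (a b c d : {additive X -> X}) (h t : X),
    forall x y : X, S (x, y) = (a x + b y + h, c x + d y + t).

Definition isomorphic (X X' : Type)
    (S : X * X -> X * X) (S' : X' * X' -> X' * X') : Prop :=
  exists2 theta : X -> X', bijective theta &
    forall x y : X,
      S' (theta x, theta y) = (theta (S (x, y)).1, theta (S (x, y)).2).

Definition indecomposable_affine_solution (p : nat) (X : finZmodType)
    (S : X * X -> X * X) : Prop :=
  [/\ #|X| = p, solution S, indecomposable S & affine S].

(* For prime [p], ['F_p] is Z/pZ. *)
Definition sol_i (p : nat) (q1 q2 h : 'F_p) (u : 'F_p * 'F_p) : 'F_p * 'F_p :=
  let: (x, y) := u in
  (q1^-1 * y + (1 - q2 * q1^-1) * x + h, q2 * x - q1 * h).

Definition sol_ii (p : nat) (q1 q2 h : 'F_p) (u : 'F_p * 'F_p) : 'F_p * 'F_p :=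
  let: (x, y) := u in
  (q1^-1 * y + h, q2 * x + (1 - q2 * q1^-1) * y - q2 * h).

Definition sol_iii (p : nat) (h1 h2 : 'F_p) (u : 'F_p * 'F_p) : 'F_p * 'F_p :=
  let: (x, y) := u in (y + h1, x + h2).

(* Main.v *)
(** An affine map [(x, y) |-> (a x + b y + h, c x + d y + t)] with [b, c != 0]
satisfies the braid relation iff [a d = 0], one of [a = 0], [a + b c = 1] and
one of [d = 0], [d + b c = 1] holds, and three conditions on [h, t] hold.  The
cases [a != 0] and [d != 0] are the families (i) and (ii).  If [a = d = 0], then
[(c - 1) h = (b - 1) t], so [y |-> b y + h] and [x |-> c x + t] have a common
fixed point unless [b = c = 1]; splitting off that point decomposes the
solution.

For the converse, a subset closed under [(x, y) |-> a x + b y + h] with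
[a, b != 0] and containing two points [x != x'] is, by finiteness, closed under
translation by [a (x - x')], hence is everything.  Since [0, q1, q2] are
distinct, one of two complementary subsets contains two points. *)
From HB Require Import structures.
Require Import Defs.
From mathcomp Require Import all_boot all_algebra.
From mathcomp Require Import ring.

Set Implicit Arguments.
Unset Strict Implicit.
Unset Printing Implicit Defensive.

Import GRing.Theory.
Local Open Scope ring_scope.

(** [finv f x] is by definition an iterate of [f] at [x], so induction on the number of iterations
    applies. *)
Lemma finv_stable (T : finType) (A : T -> Prop) (f : T -> T) :
  (forall x, A x -> A (f x)) -> forall x, A x -> A (finv f x).
Proof. by move=> fA x Ax; rewrite /finv; elim: (_.-1) => //= n /fA. Qed.

(** * Transport along isomorphisms *)

Lemma eq_isomorphic (X : Type) (S S' : X * X -> X * X) :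
  S =1 S' -> isomorphic S S'.
Proof.
by move=> eqS; exists id; [exists id|move=> x y; rewrite -eqS -surjective_pairing].
Qed.

Lemma isomorphic_eqr (X X' : Type) (S : X * X -> X * X)
    (S' S'' : X' * X' -> X' * X') :
  S' =1 S'' -> isomorphic S S' -> isomorphic S S''.
Proof. by move=> eqS [th bij_th SS']; exists th => // x y; rewrite -eqS SS'. Qed.

(** [S'] is the conjugate of [S] by [th], and each clause is preserved by conjugation. *)
Lemma isomorphic_solution (X X' : Type) (S : X * X -> X * X)
    (S' : X' * X' -> X' * X') :
  isomorphic S S' -> solution S -> solution S'.
Proof.
case=> th [th' thK th'K] SS' [[[x0] [T SK TK] br] [gS fS]].
have S'E x y : S' (x, y) = (th (S (th' x, th' y)).1, th (S (th' x, th' y)).2).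
  by rewrite -SS' !th'K.
split; [split=> //|split].
- by constructor; exact: th x0.
- exists (fun u => let v := T (th' u.1, th' u.2) in (th v.1, th v.2)).
    by case=> x y; rewrite S'E /= !thK -surjective_pairing SK /= !th'K.
  case=> x y /=; rewrite SS' -surjective_pairing TK /= !th'K //.
- case=> [[x y] z]; have := br (th' x, th' y, th' z).
  rewrite /= !S'E /= !thK.
  case: (S (th' x, th' y)) => x1 y1 /=; case: (S (th' y, th' z)) => y2 z2 /=.
  rewrite !S'E /= !thK.
  case: (S (y1, th' z)) => y3 z3 /=; case: (S (th' x, y2)) => x4 y4 /=.
  by case: (S (x1, y3)) => ? ? /=; case: (S (y4, z2)) => ? ? /= [-> -> ->].
- move=> x; apply: (eq_bij (f := th \o (fun y => (S (th' x, y)).1) \o th')).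
    by apply: bij_comp; [apply: bij_comp => //; exists th'|exists th].
  by move=> y /=; rewrite S'E.
- move=> y; apply: (eq_bij (f := th \o (fun x => (S (x, th' y)).2) \o th')).
    by apply: bij_comp; [apply: bij_comp => //; exists th'|exists th].
  by move=> x /=; rewrite S'E.
Qed.

Lemma isomorphic_indecomposable (X X' : Type) (S : X * X -> X * X)
    (S' : X' * X' -> X' * X') :
  isomorphic S S' -> indecomposable S -> indecomposable S'.
Proof.
case=> th [th' thK th'K] SS' indS [X1 [X2 [[[x1 X1x] [x2 X2x]] cov dis st1 st2]]].
apply: indS; exists (X1 \o th), (X2 \o th); split=> //=.
- by split; [exists (th' x1)|exists (th' x2)]; rewrite /= th'K.
- by move=> x y /= Ax Ay; have := st1 _ _ Ax Ay; rewrite SS'.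
- by move=> x y /= Ax Ay; have := st2 _ _ Ax Ay; rewrite SS'.
Qed.

(** The coefficients are scalars: every endomorphism of Z_p is a multiplication. *)
Definition affine_map (F : fieldType) (a b c d h t : F) (u : F * F) : F * F :=
  (a * u.1 + b * u.2 + h, c * u.1 + d * u.2 + t).

Lemma affine_map_affine (F : fieldType) (a b c d h t : F) :
  affine (affine_map a b c d h t).
Proof.
by exists (a \*o idfun : {additive F -> F}), (b \*o idfun : {additive F -> F}),
  (c \*o idfun : {additive F -> F}), (d \*o idfun : {additive F -> F}), h, t.
Qed.

(** * Affine solutions over a field *)

Section AffineSolution.

Variable F : fieldType.
Implicit Types a b c d h t : F.

Lemma affine_map_solution a b c d h t :
  b != 0 -> c != 0 ->
  [/\ a * d = 0, a * (a + b * c - 1) = 0 & d * (d + b * c - 1) = 0] ->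
  [/\ a * (h + b * t) = 0, d * (c * h + t) = 0 &
      c * h + d * h + t = a * t + b * t + h] ->
  solution (affine_map a b c d h t).
Proof.
move=> b0 c0 [ad aa dd] [ah dt ht].
(* The determinant of the linear part reduces to [- (b * c)]; the inverse below is Cramer's rule. *)
have bc0 : a * d - b * c != 0 by rewrite ad sub0r oppr_eq0 mulf_neq0.
split; [split|split].
- by constructor; exact: 0.
- exists (fun u => ((d * (u.1 - h) - b * (u.2 - t)) / (a * d - b * c),
                   (a * (u.2 - t) - c * (u.1 - h)) / (a * d - b * c))).
    by case=> x y; rewrite /affine_map /=; congr (_, _); field.
  by case=> x y; rewrite /affine_map /=; congr (_, _); field.
- case=> [[x y] z]; rewrite /= /affine_map /=; congr (_, _, _).
  (* In each coordinate the difference of the two sides is a combination of expressions that vanish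
     by hypothesis. *)
  + apply/eqP; rewrite -subr_eq0; apply/eqP.
    transitivity (a * (a + b * c - 1) * x + b * (a * d) * y
                  + a * (h + b * t)); first by ring.
    by rewrite aa ad ah; ring.
  + apply/eqP; rewrite -subr_eq0; apply/eqP.
    transitivity (c * (a * d) * x + (a * d) * (d - a) * y - b * (a * d) * z
      + (c * h + d * h + t - (a * t + b * t + h)) + (a * d) * (t - h));
      first by ring.
    by rewrite ad ht; ring.
  + apply/eqP; rewrite -subr_eq0; apply/eqP.
    transitivity (- (d * (d + b * c - 1)) * z - c * (a * d) * y
                  - d * (c * h + t)); first by ring.
    by rewrite dd ad dt; ring.
- move=> x; exists (fun z => b^-1 * (z - h - a * x)) => y; rewrite /=; by field.
- move=> y; exists (fun z => c^-1 * (z - t - d * y)) => x; rewrite /=; by field.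
Qed.

(** The braid relation is evaluated at the origin and at the three unit vectors; subtracting the
    value at the origin isolates the linear coefficients. *)
Lemma affine_map_solution_inv a b c d h t :
  solution (affine_map a b c d h t) ->
  [/\ b != 0, c != 0 &
  [/\ a * d = 0, a * (a + b * c - 1) = 0 & d * (d + b * c - 1) = 0] /\
  [/\ a * (h + b * t) = 0, d * (c * h + t) = 0 &
      c * h + d * h + t = a * t + b * t + h]].
Proof.
move=> [[_ _ br] [/(_ 0) /bij_inj binj /(_ 0) /bij_inj cinj]].
have b0 : b != 0.
  (* With [b = 0] an injective map would be constant. *)
  apply/eqP=> b0; have /eqP := oner_neq0 F; apply; apply: binj.
  by rewrite /= b0; ring.
have c0 : c != 0.
  apply/eqP=> c0; have /eqP := oner_neq0 F; apply; apply: cinj.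
  by rewrite /= c0; ring.
have := br (0, 0, 0); have := br (1, 0, 0).
have := br (0, 1, 0); have := br (0, 0, 1).
(* [x], [y], [z] name the three unit vectors and [k] the origin; the digit is the coordinate. *)
rewrite /= /affine_map /= => -[z1 z2 z3] [y1 y2 y3] [x1 x2 x3] [k1 k2 k3].
have subE u v u' v' : u = v -> u' = v' -> (u - v) - (u' - v') = 0 :> F.
  by move=> -> ->; rewrite !subrr.
have ad : a * d = 0.
  (* In the first coordinate the middle variable has coefficient [b * (a * d)]. *)
  by apply: (mulfI b0); apply: etrans (etrans (subE _ _ _ _ y1 k1) _); ring.
split=> //; split; split=> //.
- by apply: etrans (subE _ _ _ _ x1 k1); ring.
- by apply: etrans (subE _ _ _ _ k3 z3); ring.
- by apply: etrans (subE _ _ _ _ k1 (erefl 0)); ring.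
- by apply: etrans (subE _ _ _ _ (erefl 0) k3); ring.
- apply/eqP; rewrite -subr_eq0; apply/eqP.
  transitivity (0 - (a * d) * (t - h)); last by rewrite ad; ring.
  by rewrite -(subE _ _ _ _ k2 (erefl 0)); ring.
Qed.

(** The blocks are [{e}] and its complement; the latter is stable because both maps are injective
    and fix [e]. *)
Lemma common_fixpoint_decomposable b c h t e :
  b != 0 -> c != 0 -> b * e + h = e -> c * e + t = e ->
  decomposable (affine_map 0 b c 0 h t).
Proof.
move=> b0 c0 be ce; exists (fun x => x = e), (fun x => x <> e); split.
- split; [by exists e|exists (e + 1)] => /eqP.
  by rewrite -subr_eq0 addrC addKr oner_eq0.
- by move=> x; case: (eqVneq x e) => [|/eqP]; [left|right].
- by move=> x [].
- by move=> x y -> ->; rewrite /affine_map /= !mul0r add0r addr0.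
- move=> x y xe ye; rewrite /affine_map /= !mul0r add0r addr0.
  by split; [rewrite -be => /addIr /(mulfI b0) | rewrite -ce => /addIr /(mulfI c0)].
Qed.

Lemma indecomposable_permutational b c h t :
  solution (affine_map 0 b c 0 h t) ->
  indecomposable (affine_map 0 b c 0 h t) ->
  [/\ b = 1, c = 1 & (h, t) != (0, 0)].
Proof.
move=> /affine_map_solution_inv [b0 c0 [_ [_ _ ht]]] ind.
have noe e : b * e + h = e -> c * e + t = e -> False.
  by move=> be ce; apply: ind; apply: common_fixpoint_decomposable be ce.
case: (eqVneq b 1) => [b1|b1]; last first.
  have b10 : 1 - b != 0 by rewrite subr_eq0 eq_sym.
  (* This is the fixed point of [y |-> b y + h]; [ht] amounts to [(1 - b) t = (1 - c) h], so the
     other map fixes it too. *)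
  case: (noe (h / (1 - b))); first by field.
  have -> : t = (1 - c) * h / (1 - b); last by field.
  apply: (mulIf b10); rewrite divfK //.
  apply/eqP; rewrite -subr_eq0; apply/eqP.
  by move: ht => /eqP; rewrite -subr_eq0 => /eqP <-; ring.
case: (eqVneq c 1) => [c1|c1]; last first.
  have c10 : 1 - c != 0 by rewrite subr_eq0 eq_sym.
  (* With [b = 1], [ht] becomes [(1 - c) h = 0]; then the first map is the identity. *)
  have h0 : h = 0.
    apply: (mulfI c10); rewrite mulr0.
    apply: oppr_inj; rewrite oppr0.
    by move: ht => /eqP; rewrite -subr_eq0 b1 => /eqP <-; ring.
  by case: (noe (t / (1 - c))); rewrite ?b1 ?h0; field.
split=> //; apply/eqP=> -[h0 t0].
by case: (noe 0); rewrite ?h0 ?t0; ring.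
Qed.

End AffineSolution.

(** * Stable subsets of ['F_p] *)

Section PrimeField.

Variable p : nat.
Implicit Types (a b h r x y : 'F_p) (A : 'F_p -> Prop).

Lemma translation_stable_full A r x :
  r != 0 -> A x -> (forall y, A y -> A (y + r)) -> forall y, A y.
Proof.
move=> r0 Ax Ar y.
(* Read as a natural number, [k] counts the translations by [r] leading from [x] to [y]. *)
pose k := r^-1 * (y - x).
have -> : y = x + r *+ k by rewrite -mulr_natr natr_Zp mulVKf // addrC subrK.
by elim: (nat_of_ord k) => [|n /Ar]; rewrite ?addr0 // mulrSr addrA.
Qed.

Lemma affine_closed_full A a b h x x' :
  a != 0 -> b != 0 -> (forall u v, A u -> A v -> A (a * u + b * v + h)) ->
  A x -> A x' -> x != x' -> forall y, A y.
Proof.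
(* [f] is a permutation preserving [A], hence so is its inverse. Undoing [f], then redoing it with
   [x] in place of [x'], translates by [a * (x - x')]. *)
move=> a0 b0 stA Ax Ax' xx'; set f := fun y => a * x' + b * y + h.
have injf : injective f by move=> u v /addIr /addrI /(mulfI b0).
apply: (@translation_stable_full _ (a * (x - x')) x) => //.
  by rewrite mulf_neq0 // subr_eq0.
move=> y Ay.
have Afy : A (finv f y) by apply: finv_stable Ay => v; exact: stA.
have <- : a * x + b * finv f y + h = y + a * (x - x').
  by rewrite -{2}(f_finv injf y) /f; ring.
exact: stA.
Qed.

(** Controlling one component of [S] suffices: the first for (i), the second for (ii). The points
    [0], [q1], [q2] feed a pigeonhole argument. *)
Lemma indecomposable_affine_component (S : 'F_p * 'F_p -> 'F_p * 'F_p)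
    a b h (q1 q2 : 'F_p) :
  a != 0 -> b != 0 -> q1 != 0 -> q2 != 0 -> q1 != q2 ->
  (forall A u v, square_stable S A -> A u -> A v -> A (a * u + b * v + h)) ->
  indecomposable S.
Proof.
move=> a0 b0 q10 q20 q12 stS.
case=> X1 [X2 [[[x1 X1x] [x2 X2x]] cov dis st1 st2]].
have full1 x y : X1 x -> X1 y -> x != y -> False.
  move=> Xx Xy xy; apply: (dis x2); split=> //.
  exact: (affine_closed_full a0 b0 (fun u v => stS X1 u v st1) Xx Xy xy).
have full2 x y : X2 x -> X2 y -> x != y -> False.
  move=> Xx Xy xy; apply: (dis x1); split=> //.
  exact: (affine_closed_full a0 b0 (fun u v => stS X2 u v st2) Xx Xy xy).
case: (cov 0) => A0; case: (cov q1) => A1; case: (cov q2) => A2.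
all: by [exact: full1 A1 A0 q10 | exact: full1 A2 A0 q20 | exact: full1 A1 A2 q12
  | exact: full2 A1 A0 q10 | exact: full2 A2 A0 q20 | exact: full2 A1 A2 q12].
Qed.

(** * The three families *)

Lemma sol_iE (q1 q2 h : 'F_p) :
  sol_i q1 q2 h =1 affine_map (1 - q2 * q1^-1) q1^-1 q2 0 h (- (q1 * h)).
Proof. by case=> x y; rewrite /affine_map /=; congr (_, _); ring. Qed.

Lemma sol_iiE (q1 q2 h : 'F_p) :
  sol_ii q1 q2 h =1 affine_map 0 q1^-1 q2 (1 - q2 * q1^-1) h (- (q2 * h)).
Proof. by case=> x y; rewrite /affine_map /=; congr (_, _); ring. Qed.

Lemma sol_iiiE (h1 h2 : 'F_p) : sol_iii h1 h2 =1 affine_map 0 1 1 0 h1 h2.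
Proof. by case=> x y; rewrite /affine_map /=; congr (_, _); ring. Qed.

Lemma indecomposable_affine_solution_affine_map
    (S : 'F_p * 'F_p -> 'F_p * 'F_p) (a b c d h t : 'F_p) :
  prime p -> S =1 affine_map a b c d h t -> solution (affine_map a b c d h t) ->
  indecomposable S -> indecomposable_affine_solution p S.
Proof.
move=> p_pr SE sol ind; split=> //; first exact: card_Fp.
  by apply: isomorphic_solution sol; apply: eq_isomorphic => u; rewrite SE.
have [a' [b' [c' [d' [h' [t' E]]]]]] := affine_map_affine a b c d h t.
by exists a', b', c', d', h', t' => x y; rewrite SE E.
Qed.

Lemma sub1_ratio_neq0 (q1 q2 : 'F_p) : q1 != 0 -> q1 != q2 -> 1 - q2 * q1^-1 != 0.
Proof.
move=> q10; apply: contra; rewrite subr_eq0 => /eqP E.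
by rewrite -[q1]mul1r E divfK.
Qed.

Hypothesis p_prime : prime p.

Lemma sol_i_indecomposable (q1 q2 h : 'F_p) :
  q1 != 0 -> q2 != 0 -> q1 != q2 ->
  indecomposable_affine_solution p (sol_i q1 q2 h).
Proof.
move=> q10 q20 q12; have a0 := sub1_ratio_neq0 q10 q12.
have b0 : q1^-1 != 0 by rewrite invr_eq0.
apply: indecomposable_affine_solution_affine_map (sol_iE q1 q2 h) _ _ => //.
  by apply: affine_map_solution => //; split; field.
apply: (indecomposable_affine_component (a := 1 - q2 * q1^-1) (b := q1^-1)
  (h := h) a0 b0 q10 q20 q12) => A u v st Au Av.
by have [+ _] := st _ _ Au Av; rewrite /= [q1^-1 * v + _]addrC.
Qed.

Lemma sol_ii_indecomposable (q1 q2 h : 'F_p) :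
  q1 != 0 -> q2 != 0 -> q1 != q2 ->
  indecomposable_affine_solution p (sol_ii q1 q2 h).
Proof.
move=> q10 q20 q12; have d0 := sub1_ratio_neq0 q10 q12.
have b0 : q1^-1 != 0 by rewrite invr_eq0.
apply: indecomposable_affine_solution_affine_map (sol_iiE q1 q2 h) _ _ => //.
  by apply: affine_map_solution => //; split; field.
apply: (indecomposable_affine_component (a := q2) (b := 1 - q2 * q1^-1)
  (h := - (q2 * h)) q20 d0 q10 q20 q12) => A u v st Au Av.
by have [_] := st _ _ Au Av.
Qed.

(** On the diagonal, [(y, y)] goes to [(y + h1, y + h2)], so a stable subset is closed under both
    translations, one of which is nontrivial. *)
Lemma sol_iii_indecomposable (h1 h2 : 'F_p) :
  (h1, h2) != (0, 0) -> indecomposable_affine_solution p (sol_iii h1 h2).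
Proof.
move=> h0.
apply: indecomposable_affine_solution_affine_map (sol_iiiE h1 h2) _ _ => //.
  by apply: affine_map_solution; rewrite ?oner_neq0 //; split; ring.
case=> X1 [X2 [[[x1 X1x] [x2 X2x]] cov dis st1 st2]].
apply: (dis x2); split=> //.
have [h10|h10] := eqVneq h1 0.
  have h20 : h2 != 0 by apply: contraNneq h0 => ->; rewrite h10.
  apply: translation_stable_full h20 X1x _ _ => y Xy.
  by have [] := st1 _ _ Xy Xy.
apply: translation_stable_full h10 X1x _ _ => y Xy.
by have [] := st1 _ _ Xy Xy.
Qed.

(** * Reduction from groups of prime order to ['F_p] *)

Lemma zmod_prime_isomorphism (X : finZmodType) :
  #|X| = p -> exists2 th : {additive X -> 'F_p}, bijective th
    & forall f : {additive X -> X}, exists m, forall x : X, th (f x) = m * th x.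
Proof.
move=> cX.
have pX (x : X) : x *+ p = 0.
  (* Translation by [x] permutes [X], so the sum of all elements is unchanged when [x *+ p] is
     added. *)
  apply: (addIr (\sum_(y : X) y)); rewrite add0r.
  by rewrite [RHS](reindex_inj (addrI x)) big_split sumr_const -cX.
have [g g0] : exists g : X, g != 0.
  apply/existsP; apply: contraLR (prime_gt1 p_prime).
  rewrite negb_exists -leqNgt -cX => /forallP g0.
  rewrite -(card1 (0 : X)); apply: subset_leq_card.
  by apply/subsetP=> x _; rewrite inE; have := g0 x; rewrite negbK.
have modX (x : X) n : x *+ (n %% p) = x *+ n.
  by rewrite {2}(divn_eq n p) mulrnDr mulnC mulrnA pX mul0rn add0r.
(* Any nonzero [g] generates [X]; [th] will be the inverse of [psi]. *)
pose psi (k : 'F_p) : X := g *+ k.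
have psiD : {morph psi : k l / k + l}.
  move=> k l; rewrite /psi -mulrnDr -(modX _ (k + l)%N) -val_Fp_nat //.
  by rewrite natrD !natr_Zp.
have psi_ker k : psi k = 0 -> k = 0.
  move=> k0; apply/eqP; apply: contraNT g0 => kN0.
  have cpk : coprime k p.
    rewrite coprime_sym prime_coprime // gtnNdvd ?lt0n //.
    by have := ltn_ord k; rewrite [X in (_ < X)%N -> _]Fp_cast.
  have k_gt0 : (0 < k)%N by rewrite lt0n.
  (* Bezout: [u * k = v * p + 1], and both [g *+ k] and [g *+ p] vanish, so [g = 0]. *)
  have [u v uv _] := egcdnP p k_gt0.
  move: uv; rewrite (eqP cpk) => uv.
  have : g *+ (u * k) = g *+ (v * p + 1) by rewrite uv.
  rewrite mulnC mulrnA -/(psi k) k0 mul0rn mulrnDr mulnC mulrnA pX mul0rn add0r.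
  by rewrite mulr1n => <-.
have psi_inj : injective psi.
  move=> k l kl; apply/eqP; rewrite -subr_eq0; apply/eqP/psi_ker.
  by apply: (addIr (psi l)); rewrite -psiD subrK add0r.
have [th psiK thK] : bijective psi.
  by apply: inj_card_bij => //; rewrite cX card_Fp.
have thB : zmod_morphism th.
  move=> x y; apply: psi_inj; apply: (addIr (psi (th y))).
  by rewrite -[RHS]psiD subrK !thK subrK.
pose thA := GRing.isZmodMorphism.Build _ _ th thB.
pose tha : {additive X -> 'F_p} := HB.pack th thA.
exists tha => [|f]; first by exists psi.
(* [f] is determined by its value at the generator [g]. *)
exists (th (f g)) => x.
rewrite -{1}[x]thK.
by rewrite -[LHS]/(tha (f (g *+ th x))) !raddfMn -mulr_natr natr_Zp.
Qed.

Lemma affine_isomorphic_affine_map (X : finZmodType) (S : X * X -> X * X) :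
  #|X| = p -> affine S ->
  exists a b c d h t : 'F_p, isomorphic S (affine_map a b c d h t).
Proof.
move=> cX [a [b [c [d [h [t SE]]]]]].
have [th bij_th lin] := zmod_prime_isomorphism cX.
have [a' aE] := lin a; have [b' bE] := lin b.
have [c' cE] := lin c; have [d' dE] := lin d.
exists a', b', c', d', (th h), (th t), th => // x y.
by rewrite SE /= !raddfD aE bE cE dE.
Qed.

End PrimeField.

Theorem theorem2p5 (p : nat) (p_prime : prime p) :
  [/\ forall q1 q2 h : 'F_p, q1 != 0 -> q2 != 0 -> q1 != q2 ->
        indecomposable_affine_solution p (sol_i q1 q2 h),
      forall q1 q2 h : 'F_p, q1 != 0 -> q2 != 0 -> q1 != q2 ->
        indecomposable_affine_solution p (sol_ii q1 q2 h)
    & forall h1 h2 : 'F_p, (h1, h2) != (0, 0) ->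
        indecomposable_affine_solution p (sol_iii h1 h2)]
  /\
  (forall (X : finZmodType) (S : X * X -> X * X),
     indecomposable_affine_solution p S ->
     [\/ exists q1 q2 h : 'F_p,
           [/\ q1 != 0, q2 != 0, q1 != q2 & isomorphic S (sol_i q1 q2 h)],
         exists q1 q2 h : 'F_p,
           [/\ q1 != 0, q2 != 0, q1 != q2 & isomorphic S (sol_ii q1 q2 h)]
       | exists h1 h2 : 'F_p,
           (h1, h2) != (0, 0) /\ isomorphic S (sol_iii h1 h2)]).
Proof.
split; first split.
- exact: sol_i_indecomposable.
- exact: sol_ii_indecomposable.
- exact: sol_iii_indecomposable.
move=> X S [cX solS indS affS].
have [a [b [c [d [h [t iso]]]]]] := affine_isomorphic_affine_map p_prime cX affS.
have solS' := isomorphic_solution iso solS.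
have indS' := isomorphic_indecomposable iso indS.
have [b0 c0 [[ad aa dd] [ah dt ht]]] := affine_map_solution_inv solS'.
have q10 : b^-1 != 0 by rewrite invr_eq0.
(* Used with [e = a] and [e = d]: [b^-1 = c] would give [b * c = 1], hence [e = 0]. *)
have b_neq e : e != 0 -> e + b * c - 1 = 0 -> b^-1 != c.
  move=> e0 eE; apply: contraNneq e0 => bc.
  by rewrite -eE -bc divff // addrK.
have [a0|a0] := eqVneq a 0; last first.
  (* Cancelling [a] leaves [d = 0], [a = 1 - b c] and [h = - b t]: family (i) with [q1 = b^-1],
     [q2 = c]. *)
  have d0 : d = 0 by apply: (mulfI a0); rewrite mulr0.
  have aE : a + b * c - 1 = 0 by apply: (mulfI a0); rewrite mulr0.
  have hE : h + b * t = 0 by apply: (mulfI a0); rewrite mulr0.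
  apply: Or31; exists b^-1, c, h; split=> //; first exact: b_neq aE.
  apply: isomorphic_eqr iso => u; rewrite sol_iE invrK d0.
  congr (affine_map _ _ _ _ _ _ _).
    by apply/eqP; rewrite -subr_eq0 -aE; apply/eqP; ring.
  by apply: (mulfI b0); apply/eqP; rewrite -subr_eq0 -hE; apply/eqP; field.
have [d0|d0] := eqVneq d 0; last first.
  (* Cancelling [d] gives family (ii) with the same parameters. *)
  have dE : d + b * c - 1 = 0 by apply: (mulfI d0); rewrite mulr0.
  have tE : c * h + t = 0 by apply: (mulfI d0); rewrite mulr0.
  apply: Or32; exists b^-1, c, h; split=> //; first exact: b_neq dE.
  apply: isomorphic_eqr iso => u; rewrite sol_iiE invrK a0.
  congr (affine_map _ _ _ _ _ _ _).
    by apply/eqP; rewrite -subr_eq0 -dE; apply/eqP; ring.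
  by apply/eqP; rewrite -subr_eq0 -tE; apply/eqP; ring.
subst a d; have [b1 c1 ht0] := indecomposable_permutational solS' indS'.
apply: Or33; exists h, t; split=> //.
by apply: isomorphic_eqr iso => u; rewrite sol_iiiE b1 c1.
Qed.
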